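(* Let $T\in M^{m\times n}(\mathbb{C})$ and $W\in M^{m\times r}(\mathbb{C})$ be such that $\mathcal{R}(W)\subseteq\mathcal{R}(T)$, and let $\mathcal{M}$ be a subspace of $\mathbb{C}^n$ such that $\mathcal{M}\overset{.}{+}\mathcal{N}(T)=\mathbb{C}^n$. Let $T=U-V$ be a proper splitting of $T$. Let $Y_{\mathcal{M}}\in M^{n}(\mathbb{C})$ and $Z_{\mathcal{M}}\in M^{n\times r}(\mathbb{C})$ be the reduced solutions for $\mathcal{M}$ of $UY=V$ and $UZ=W$, respectively. Then the iterative process $$X^{i+1}=Y_{\mathcal{M}}X^{i}+Z_{\mathcal{M}}$$ is convergent for all initial $X^0\in M^{n\times r}(\mathbb{C})$ if and only if $\rho(Y_{\mathcal{M}})<1$. In such case, the limit of the iterative process coincides with $X_{\mathcal{M}}$, the reduced solution for $\mathcal{M}$ of the equation $TX=W$.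
   Context: $M^{m\times n}(\mathbb{C})$ denotes the complex $m\times n$ matrices and $M^n(\mathbb{C})=M^{n\times n}(\mathbb{C})$; $\mathcal{R}(\cdot)$, $\mathcal{N}(\cdot)$, $\rho(\cdot)$ denote range, nullspace and spectral radius; $\overset{.}{+}$ denotes direct sum of subspaces. Proper splitting: a decomposition $T=U-V$ with $U,V\in M^{m\times n}(\mathbb{C})$ is a proper splitting of $T\in M^{m\times n}(\mathbb{C})$ if $\mathcal{R}(U)=\mathcal{R}(T)$ and $\mathcal{N}(U)=\mathcal{N}(T)$. In that case $\mathcal{R}(V)\subseteq\mathcal{R}(T)$ and $\mathcal{N}(T)\subseteq\mathcal{N}(V)$. Reduced solution: if $A\in M^{m\times n}(\mathbb{C})$, $B\in M^{m\times r}(\mathbb{C})$, $\mathcal{R}(B)\subseteq\mathcal{R}(A)$ and $\mathcal{M}\overset{.}{+}\mathcal{N}(A)=\mathbb{C}^n$, there is a unique $X_{\mathcal{M}}\in M^{n\times r}(\mathbb{C})$ with $AX_{\mathcal{M}}=B$ and $\mathcal{R}(X_{\mathcal{M}})\subseteq\mathcal{M}$; it is called the reduced solution for $\mathcal{M}$ of $AX=B$. *)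

(* Defs.v *)
From HB Require Import structures.
From mathcomp Require Import all_boot all_order all_algebra.
From mathcomp Require Import all_classical all_reals all_analysis.
From mathcomp Require Import complex.

Set Implicit Arguments.
Unset Strict Implicit.
Unset Printing Implicit Defensive.

Import Order.TTheory GRing.Theory Num.Theory.
Import numFieldNormedType.Exports.

Local Open Scope classical_set_scope.
Local Open Scope ring_scope.

(* The libraries do not equip R[i] with a topology; it receives the one that
   every numClosedFieldType carries, i.e., that of its modulus. *)
HB.instance Definition _ (R : realType) :=
  PseudoPointedMetric.copy R[i] (R[i] : numClosedFieldType).

(* Matrices act on column vectors, whereas the row-space operations of
   mxalgebra describe the action on row vectors. *)
Definition mxrange (F : fieldType) (m n : nat) (A : 'M[F]_(m, n)) :
    {vspace 'cV[F]_m} :=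
  limg (linfun (mulmx A : 'cV[F]_n -> 'cV[F]_m)).

Definition mxnull (F : fieldType) (m n : nat) (A : 'M[F]_(m, n)) :
    {vspace 'cV[F]_n} :=
  lker (linfun (mulmx A : 'cV[F]_n -> 'cV[F]_m)).

Definition complementary (F : fieldType) (vT : vectType F)
    (M N : {vspace vT}) : Prop :=
  directv (M + N) /\ (M + N = fullv)%VS.

Definition proper_splitting (F : fieldType) (m n : nat)
    (T U V : 'M[F]_(m, n)) : Prop :=
  [/\ T = U - V, mxrange U = mxrange T & mxnull U = mxnull T].

Definition is_reduced_solution (F : fieldType) (m n r : nat)
    (M : {vspace 'cV[F]_n}) (A : 'M[F]_(m, n)) (B : 'M[F]_(m, r))
    (X : 'M[F]_(n, r)) : Prop :=
  A *m X = B /\ (mxrange X <= M)%VS.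

(* The spectrum is finite, so the supremum is a maximum (and 0 if n = 0).
   [eigenvalue] is about row eigenvectors, which does not affect the
   spectrum of a square matrix. *)
Definition spectral_radius (R : realType) (n : nat) (A : 'M[R[i]]_n) : R :=
  sup [set Normc.normc a | a in [set a : R[i] | eigenvalue A a]].

Definition iterates (F : fieldType) (n r : nat) (Y : 'M[F]_n)
    (Z X0 : 'M[F]_(n, r)) (i : nat) : 'M[F]_(n, r) :=
  iter i (fun X => Y *m X + Z) X0.

Section ReducedSolution.
Variable F : fieldType.

Lemma mem_mxrange m n (A : 'M[F]_(m, n)) (y : 'cV[F]_m) :
  reflect (exists x, y = A *m x) (y \in mxrange A).
Proof.
apply: (iffP memv_imgP) => [[x _ ->]|[x ->]]; exists x; rewrite ?memvf ?lfunE //.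
Qed.

Lemma mem_mxnull m n (A : 'M[F]_(m, n)) (x : 'cV[F]_n) :
  (x \in mxnull A) = (A *m x == 0).
Proof. by rewrite memv_ker lfunE. Qed.

Lemma mxrange_subP m n (A : 'M[F]_(m, n)) (M : {vspace 'cV[F]_m}) :
  reflect (forall j, col j A \in M) (mxrange A <= M)%VS.
Proof.
apply: (iffP subvP) => [sAM j|AM y /mem_mxrange[x ->]].
  by apply/sAM/mem_mxrange; exists (delta_mx j ord0); rewrite colE.
rewrite (_ : A *m x = \sum_j x j ord0 *: col j A).
  by apply: memv_suml => j _; rewrite memvZ.
apply/colP => i; rewrite !mxE summxE; apply: eq_bigr => j _.
by rewrite !mxE mulrC.
Qed.

Lemma exists_unique_reduced_solution m n r (M : {vspace 'cV[F]_n})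
    (A : 'M[F]_(m, n)) (B : 'M[F]_(m, r)) :
  (mxrange B <= mxrange A)%VS -> complementary M (mxnull A) ->
  exists! X, is_reduced_solution M A B X.
Proof.
move=> /mxrange_subP sBA [/directv_addP dMN sMN].
have col_ex j : exists x, x \in M /\ A *m x = col j B.
  have /mem_mxrange[x ->] := sBA j.
  have : x \in (M + mxnull A)%VS by rewrite sMN memvf.
  case/memv_addP=> u uM [v + ->]; rewrite mem_mxnull => /eqP Av.
  by exists u; rewrite mulmxDr Av addr0.
have [x xP] := choice col_ex.
pose X := \matrix_(i, j) x j i ord0.
have colX j : col j X = x j by apply/colP => i; rewrite !mxE.
exists X; split.
  split; last by apply/mxrange_subP => j; rewrite colX; have [] := xP j.
  apply/matrixP => i j; have [_ /colP/(_ i)] := xP j.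
  by rewrite -colX colE mulmxA -colE !mxE.
move=> X' [AX' /mxrange_subP sX'M]; apply/matrixP => i j.
suff : col j X - col j X' \in (M :&: mxnull A)%VS.
  rewrite dMN memv0 subr_eq0 => /eqP/colP/(_ i).
  by rewrite !mxE.
have [xM Axj] := xP j.
rewrite memv_cap memvB ?colX//= mem_mxnull mulmxBr Axj.
by rewrite (colE j X') mulmxA AX' -colE subrr.
Qed.

End ReducedSolution.

(* Main.v *)
(* If [X] is the reduced solution of [T X = W], both [X] and [Y X + Z] are
   reduced solutions of one equation with coefficient [U], so [X = Y X + Z] and
   [X^i - X = Y^i (X^0 - X)].  When [rho Y < 1], [Y^i D --> 0] follows from
   Cayley-Hamilton: if [(Y - a_1) ... (Y - a_s) D = 0], induct on [s] with the
   recurrence [Y^(k+1) D = a Y^k D + Y^k (Y - a) D].  Conversely, an eigenvalue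
   [a] makes [a^k] convergent, hence [|a| < 1] or [a = 1]; and [a = 1] is
   impossible, as a fixed vector of [Y] lies in both [M] and the kernel of [T].
*)
Require Import Defs.
From HB Require Import structures.
From mathcomp Require Import all_boot all_order all_algebra.
From mathcomp Require Import all_classical all_reals all_analysis.
From mathcomp Require Import complex ring.

Set Implicit Arguments.
Unset Strict Implicit.
Unset Printing Implicit Defensive.

Import Order.TTheory GRing.Theory Num.Theory.
Import numFieldNormedType.Exports.

Local Open Scope classical_set_scope.
Local Open Scope ring_scope.

(** A matrix neighbourhood contains a product of entry neighbourhoods, and finitely many eventual
    conditions eventually hold together. *)
Lemma cvg_mxP (T : topologicalType) m n (u : nat -> 'M[T]_(m, n))
    (l : 'M[T]_(m, n)) :
  u @ \oo --> l <-> forall i j, (fun k => u k i j) @ \oo --> l i j.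
Proof.
split=> [ul i j A lA|ul A [P lP PA]].
  apply: (ul [set X | A (X i j)]).
  (* The product whose [(i, j)] factor is [A] and whose other factors are the whole space. *)
  exists (fun i' j' => [set x | (i', j') = (i, j) -> A x]) => [i' j'|X XA].
    have [[-> ->]|ne] := pselect ((i', j') = (i, j)).
      by apply: filterS lA => x Ax _.
    by apply: nearW => x /ne.
  exact: XA.
have H : \forall k \near \oo, forall i j, P i j (u k i j).
  by apply: filter_forall => i; apply: filter_forall => j; apply: ul.
by apply: filterS H => k /PA.
Qed.

Lemma normcE (R : rcfType) (x : R[i]) : `|x| = (Normc.normc x)%:C%C.
Proof. by []. Qed.

Lemma normc_ge0 (R : rcfType) (x : R[i]) : 0 <= Normc.normc x.
Proof. by case: x => a b; apply: sqrtr_ge0. Qed.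

Lemma cvg0_normcP (R : realType) (u : nat -> R[i]) :
  u @ \oo --> (0 : R[i]) <-> (fun k => Normc.normc (u k)) @ \oo --> (0 : R).
Proof.
have cvgC : u @ \oo --> (0 : R[i]) <->
    forall e : R[i], 0 < e -> \forall k \near \oo, `|u k| < e.
  exact: (cvgr0Pnorm_lt (V := R[i]^o)).
rewrite cvgC; split=> [u0|/cvgr0Pnorm_lt u0 e e0].
  apply/cvgr0Pnorm_lt => e e0.
  have /u0 : 0 < e%:C%C by rewrite ltcR.
  by apply: filterS => k; rewrite normcE ltcR ger0_norm ?normc_ge0.
(* In the partial order of [R[i]], [0 < e] forces [e] to be real. *)
case: e e0 => x y; rewrite ltcE /= => /andP[/eqP-> /u0].
by apply: filterS => k; rewrite normcE ltcR /= ger0_norm ?normc_ge0.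
Qed.

Lemma cvg0_contraction (R : realType) (q : R) (a e : nat -> R) :
  0 <= q < 1 -> (forall k, 0 <= a k) ->
  (forall k, a k.+1 <= q * a k + e k) ->
  e @ \oo --> (0 : R) -> a @ \oo --> (0 : R).
Proof.
move=> /andP[q0 q1] a0 aS /cvgr0Pnorm_lt ecvg; apply/cvgr0Pnorm_lt => d d0.
have d20 : 0 < d / 2 by rewrite divr_gt0.
have q10 : 0 < 1 - q by rewrite subr_gt0.
(* With errors below [d / 2 * (1 - q)], the affine recurrence has fixed point [d / 2], whence the
   bound that follows. *)
have [N _ eN] := ecvg _ (mulr_gt0 d20 q10).
have bound j : a (j + N)%N <= q ^+ j * a N + d / 2.
  elim: j => [|j IH]; first by rewrite add0n mul1r lerDl ltW.
  apply: le_trans (aS _) _.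
  have eNj : e (j + N)%N <= d / 2 * (1 - q).
    by apply/ltW/(le_lt_trans (ler_norm _))/eN; rewrite /= leq_addl.
  rewrite exprS.
  apply: (@le_trans _ _ (q * (q ^+ j * a N + d / 2) + d / 2 * (1 - q))).
    by rewrite lerD// ler_wpM2l.
  by rewrite le_eqVlt; apply/orP; left; apply/eqP; ring.
have : geometric (a N) q @ \oo --> (0 : R).
  by apply: cvg_geometric; rewrite ger0_norm.
move=> /cvgr0Pnorm_lt/(_ _ d20)[N' _ gN'].
exists (N' + N)%N => // k /= Nk; rewrite ger0_norm//.
have [N'k kE] : (N' <= k - N)%N /\ k = (k - N + N)%N.
  by rewrite leq_subRL ?subnK ?(leq_trans _ Nk) ?leq_addl// addnC.
rewrite kE; apply: le_lt_trans (bound _) _; rewrite [ltRHS]splitr ltrD2r mulrC.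
exact: le_lt_trans (ler_norm _) (gN' _ N'k).
Qed.

(** Take for [s] the roots of the characteristic polynomial, with multiplicity, and apply
    Cayley-Hamilton. *)
Lemma char_roots_prod_eq0 (F : closedFieldType) n (A : 'M[F]_n) :
  {s : seq F | forall a, eigenvalue A a = (a \in s)
             & \prod_(a <- s) (A - a%:M) = 0}.
Proof.
have [s sE] := closed_field_poly_normal (char_poly A).
rewrite (monicP (char_poly_monic A)) scale1r in sE.
exists s => [a|]; first by rewrite eigenvalue_root_char sE root_prod_XsubC.
case: n => [|n] in A sE *; first by rewrite [LHS]flatmx0 [RHS]flatmx0.
rewrite -[RHS](Cayley_Hamilton A) sE rmorph_prod; apply: eq_bigr => a _.
by rewrite rmorphB /= horner_mx_X horner_mx_C.
Qed.

(** [A] and its transpose share their characteristic polynomial, and transposing a row eigenvector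
    of [A^T] gives a column eigenvector of [A]. *)
Lemma eigenvalue_col (F : fieldType) n (A : 'M[F]_n) a :
  eigenvalue A a -> exists2 x : 'cV[F]_n, A *m x = a *: x & x != 0.
Proof.
have -> : eigenvalue A a = eigenvalue A^T a.
  rewrite !eigenvalue_root_char /char_poly -[in RHS]det_tr.
  congr (root (\det _) a).
  by apply/matrixP => i j; rewrite !mxE eq_sym.
case/eigenvalueP => v vA v0; exists v^T; last by rewrite trmx_eq0.
by rewrite -[A]trmxK -trmx_mul vA linearZ.
Qed.

Lemma spectral_radius_lt1P (R : realType) n (A : 'M[R[i]]_n) :
  spectral_radius A < 1 <-> forall a, eigenvalue A a -> Normc.normc a < 1.
Proof.
have [s sE _] := char_roots_prod_eq0 A; rewrite /spectral_radius.
set E := [set _ | _ in _].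
(* This finite maximum bounds [E], so each modulus is at most [sup E]; and it is itself below 1 when
   every modulus is. *)
pose b := \big[Order.max/0]_(a <- s) Normc.normc a.
have ubE : ubound E b.
  by move=> _ [a + <-] => /=; rewrite sE => sa; apply: le_bigmax_seq.
split=> [s1 a Aa|A1].
  by apply: le_lt_trans s1; apply: ub_le_sup; [exists b | exists a].
have [->|/set0P E0] := eqVneq E set0; first by rewrite sup0.
apply: le_lt_trans (ge_sup E0 ubE) _.
by rewrite /b big_seq; apply: bigmax_lt => // a; rewrite -sE => /A1.
Qed.

Lemma cvg_mxpow0 (R : realType) n r (A : 'M[R[i]]_n) (D : 'M[R[i]]_(n, r)) :
  spectral_radius A < 1 ->
  (fun k => A ^+ k *m D) @ \oo --> (0 : 'M[R[i]]_(n, r)).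
Proof.
move=> /spectral_radius_lt1P; have [s sE sA] := char_roots_prod_eq0 A.
move=> A1; have {A1 sE}: forall a, a \in s -> Normc.normc a < 1.
  by move=> a; rewrite -sE => /A1.
(* The induction only needs the product to kill [D]: splitting off the last factor leaves the same
   statement for [(A - a) D]. *)
have : \prod_(a <- s) (A - a%:M) *m D = 0 by rewrite sA mul0mx.
elim/last_ind: s {sA} D => [|s a IH] D.
  rewrite big_nil mul1mx => -> _.
  by under eq_fun do rewrite mulmx0; apply: cvg_cst.
rewrite big_rcons => PD s1.
have {}IH : (fun k => A ^+ k *m ((A - a%:M) *m D)) @ \oo -->
    (0 : 'M[R[i]]_(n, r)).
  by apply: IH => [|b sb]; rewrite ?mulmxA// s1// mem_rcons inE sb orbT.
apply/cvg_mxP => i j; rewrite mxE; apply/cvg0_normcP.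
(* The recurrence is read on the modulus of one entry, with ratio [|a|] and an error that vanishes
   by induction. *)
apply: (@cvg0_contraction _ (Normc.normc a) _
  (fun k => Normc.normc ((A ^+ k *m ((A - a%:M) *m D)) i j))).
- by rewrite s1 ?mem_rcons ?mem_head// andbT normc_ge0.
- by move=> k; apply: normc_ge0.
- move=> k.
  have -> : A ^+ k.+1 *m D = a *: (A ^+ k *m D) + A ^+ k *m ((A - a%:M) *m D).
    rewrite mulmxBl mulmxBr mul_scalar_mx -scalemxAr addrC subrK.
    by rewrite exprSr -mulmxA.
  have mxZDE (N E : 'M[R[i]]_(n, r)) b : (b *: N + E) i j = b * N i j + E i j.
    by rewrite !mxE.
  by rewrite mxZDE -Normc.normcM -lecR rmorphD /= -!normcE ler_normD.
by apply/cvg0_normcP; have /cvg_mxP/(_ i j) := IH; rewrite mxE.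
Qed.

Lemma iterates_subr (F : fieldType) n r (Y : 'M[F]_n)
    (Z X X0 : 'M[F]_(n, r)) k :
  X = Y *m X + Z -> iterates Y Z X0 k - X = Y ^+ k *m (X0 - X).
Proof.
move=> fixX; elim: k => [|k IH]; first by rewrite expr0 mul1mx.
rewrite /iterates iterS {1}fixX opprD addrACA subrr addr0 -mulmxBr IH.
by rewrite exprS mulmxA.
Qed.

(** Since [U = T + V], one has [U X = W + V X = U (Y X + Z)]. *)
Lemma reduced_solution_fixpoint (F : fieldType) m n r (T U V : 'M[F]_(m, n))
    (W : 'M[F]_(m, r)) (M : {vspace 'cV[F]_n}) (Y : 'M[F]_n)
    (X Z : 'M[F]_(n, r)) :
  complementary M (mxnull T) -> proper_splitting T U V ->
  is_reduced_solution M U V Y -> is_reduced_solution M U W Z ->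
  is_reduced_solution M T W X -> X = Y *m X + Z.
Proof.
move=> hM [TE _ nullU] [UY YM] [UZ ZM] [TX XM].
have UX : U *m X = U *m (Y *m X + Z).
  by rewrite mulmxDr mulmxA UY UZ -TX TE mulmxBl addrC subrK.
have rUX : (mxrange (U *m X) <= mxrange U)%VS.
  apply/mxrange_subP => j; apply/mem_mxrange; exists (col j X).
  by rewrite !colE mulmxA.
(* As [U] and [T] have the same nullspace, [M] also complements that of [U], so the reduced solution
   with right-hand side [U X] is unique. *)
rewrite -nullU in hM.
have [X' [_ uniq]] := exists_unique_reduced_solution rUX hM.
apply: etrans (esym (uniq X _)) (uniq _ _) => //; split=> //.
apply/mxrange_subP => j; rewrite linearD /= memvD //; last first.
  exact: (mxrange_subP _ _ ZM).
apply: (subvP YM); apply/mem_mxrange; exists (col j X).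
by rewrite !colE mulmxA.
Qed.

(** If [Y x = x], then [V = U Y] gives [T x = U x - U (Y x) = 0], while [x = Y x] lies in [M]. *)
Lemma proper_splitting_eigenvalue1F (F : fieldType) m n (T U V : 'M[F]_(m, n))
    (M : {vspace 'cV[F]_n}) (Y : 'M[F]_n) :
  complementary M (mxnull T) -> proper_splitting T U V ->
  is_reduced_solution M U V Y -> ~~ eigenvalue Y 1.
Proof.
move=> [/directv_addP dMN _] [TE _ _] [UY YM].
apply/negP => /eigenvalue_col[x]; rewrite scale1r => Yx /negP; apply.
rewrite -memv0 -dMN memv_cap mem_mxnull TE mulmxBl -UY -mulmxA Yx subrr eqxx.
by rewrite andbT; apply: (subvP YM); apply/mem_mxrange; exists x.
Qed.

(** Shifting the sequence shows that its limit satisfies [a * l = l], so [l = 0] because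
    [a != 1]. *)
Lemma cvg_expr_norm_lt1 (K : numFieldType) (a c : K) :
  c != 0 -> a != 1 -> cvgn (fun k => a ^+ k * c) -> `|a| < 1.
Proof.
move=> c0 a1 /cvg_ex[l al].
have l0 : l = 0.
  have aSl : (fun k => a ^+ k.+1 * c) @ \oo --> l.
    by rewrite (cvg_shiftS (fun k => a ^+ k * c)).
  have aSal : (fun k => a ^+ k.+1 * c) @ \oo --> a * l.
    by under eq_fun do rewrite exprS -mulrA; apply: cvgMl_tmp.
  have /eqP : a * l = l by apply: (cvg_unique _ aSal aSl).
  rewrite -[X in _ == X]mul1r -subr_eq0 -mulrBl mulf_eq0 subr_eq0.
  by rewrite (negPf a1) => /eqP.
(* At tolerance [|c|], some [N] satisfies [|a| ^ N * |c| < |c|], which is impossible if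
   [1 <= |a|]. *)
move: al; rewrite l0 => /cvgr0Pnorm_lt/(_ `|c|); rewrite normr_gt0 => /(_ c0).
move=> [N _ /(_ N (leqnn N))] /=.
rewrite normrM normrX -[ltRHS]mul1r ltr_pM2r ?normr_gt0//.
apply: contraTT; rewrite -!real_leNgt ?rpredX// ?normr_real//.
exact: exprn_ege1.
Qed.

(** The condition [0 < r] matters: for [r = 0] all iterates are the same empty matrix and converge
    whatever the spectral radius of [Y]. *)
Theorem theorem5p1 (R : realType) (m n r : nat) (hr : (0 < r)%N)
    (T U V : 'M[R[i]]_(m, n)) (W : 'M[R[i]]_(m, r))
    (M : {vspace 'cV[R[i]]_n}) (Y : 'M[R[i]]_n) (Z : 'M[R[i]]_(n, r))
    (hWT : (mxrange W <= mxrange T)%VS)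
    (hM : complementary M (mxnull T))
    (hUV : proper_splitting T U V)
    (hY : is_reduced_solution M U V Y)
    (hZ : is_reduced_solution M U W Z) :
  ((forall X0 : 'M[R[i]]_(n, r), cvgn (iterates Y Z X0)) <->
     spectral_radius Y < 1) /\
  (spectral_radius Y < 1 ->
     exists2 X : 'M[R[i]]_(n, r), is_reduced_solution M T W X &
       forall X0 : 'M[R[i]]_(n, r), iterates Y Z X0 @ \oo --> X).
Proof.
have [X [redX _]] := exists_unique_reduced_solution hWT hM.
have fixX := reduced_solution_fixpoint hM hUV hY hZ redX.
have cvgX : spectral_radius Y < 1 -> forall X0, iterates Y Z X0 @ \oo --> X.
  move=> Y1 X0; rewrite -[X in _ --> X]add0r.
  rewrite (_ : iterates Y Z X0 = fun k => Y ^+ k *m (X0 - X) + X); last first.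
    by apply/funext => k; rewrite -(iterates_subr _ _ fixX) subrK.
  by apply: (cvgD (V := 'M[R[i]]_(n, r))); [exact: cvg_mxpow0 | exact: cvg_cst].
split; last by move=> Y1; exists X => // X0; exact: cvgX.
split=> [cvgY|Y1 X0]; last by apply/cvg_ex; exists X; exact: cvgX.
apply/spectral_radius_lt1P => a Ya; have [x Yx x0] := eigenvalue_col Ya.
have a1 : a != 1.
  by apply: contraTneq Ya => ->; apply: proper_splitting_eigenvalue1F hM hUV hY.
have [i xi0] : exists i, x i ord0 != 0.
  apply/existsP; apply: contraNT x0; rewrite negb_exists => /forallP x0.
  by apply/eqP/colP => i; have := x0 i; rewrite negbK mxE => /eqP.
(* Every column of [D] is the eigenvector [x], so powers of [Y] act on [D] as powers of [a]. *)
pose D : 'M[R[i]]_(n, r) := x *m const_mx 1.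
have YD k : Y ^+ k *m D = a ^+ k *: D.
  elim: k => [|k IH]; first by rewrite !expr0 mul1mx scale1r.
  by rewrite exprS -mulmxA IH -scalemxAr mulmxA Yx -scalemxAl scalerA -exprSr.
have Di : D i (Ordinal hr) = x i ord0 by rewrite mxE big_ord1 mxE mulr1.
rewrite -ltcR -normcE; apply: (cvg_expr_norm_lt1 xi0 a1).
(* Started at [D + X], the process has error [Y ^+ k *m D = a ^+ k *: D], whose entry in row [i] of
   the first column is [a ^+ k] times the nonzero [x i ord0]. *)
have /cvg_ex[L YL] := cvgY (D + X).
have YLX : (fun k => iterates Y Z (D + X) k - X) @ \oo --> L - X.
  by apply: (cvgB (V := 'M[R[i]]_(n, r))); [exact: YL | exact: cvg_cst].
apply/cvg_ex; exists ((L - X) i (Ordinal hr)).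
rewrite (_ : (fun k => _) =
             fun k => (iterates Y Z (D + X) k - X) i (Ordinal hr)).
  by move/cvg_mxP: YLX; apply.
by apply/funext => k; rewrite (iterates_subr _ _ fixX) addrK YD mxE Di.
Qed.
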